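(* The following statements are equivalent: (i) For every integer $n\ge 2$ and every balanced digraph $\Gamma$ of order $n$, \[ \alpha(\Gamma)+\alpha(\overline{\Gamma})\ge 1. \] (ii) For every integer $n\ge 2$ and any two orthonormal vectors $\mathbf{x},\mathbf{y}\in\mathbb{R}^n$ with zero mean, \[ \|\nabla_{\mathbf{x}}-\nabla_{\mathbf{y}}\|^2\ge 2, \] where $\nabla_{\mathbf{x}}\in\mathbb{R}^{\binom{n}{2}}$ is the vector whose $ij$ entry is equal to $|x_i-x_j|$, for all $1\le i<j\le n$.
   Context: A simple digraph $\Gamma=(V,E)$ of order $n$ has vertex set $V=\{1,\dots,n\}$ and edge set $E\subseteq V\times V$ with no loops and no multi-edges (both $(i,j)$ and $(j,i)$ may be edges); digraphs here are simple and unweighted. The out-degree $d^+(i)$ is the number of edges $(i,j)\in E$ and the in-degree $d^-(i)$ is the number of edges $(j,i)\in E$. $\Gamma$ is balanced if $d^+(i)=d^-(i)$ for all $i\in V$. The adjacency matrix is $A=[a_{ij}]$ with $a_{ij}=1$ if $(i,j)\in E$ and $a_{ij}=0$ otherwise, and the Laplacian matrix is $L=D-A$, where $D$ is the diagonal matrix with $i$th diagonal entry $d^+(i)$. The algebraic connectivity is \[ \alpha(\Gamma)=\min_{\mathbf{x}\in\mathbb{R}^n,\ \mathbf{x}\perp\mathbf{e},\ \|\mathbf{x}\|=1}\mathbf{x}^TL\mathbf{x}, \] where $\mathbf{e}$ is the all ones vector and $\|\cdot\|$ is the Euclidean norm. The complement $\overline{\Gamma}$ is the simple digraph on $V$ whose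 edges are exactly the ordered pairs $(i,j)$, $i\neq j$, with $(i,j)\notin E$. A vector has zero mean if the sum of its entries is $0$. *)

(* Defs.v *)
From mathcomp Require Import all_boot all_order all_algebra.
From mathcomp Require Import all_classical all_reals all_analysis.

Set Implicit Arguments.
Unset Strict Implicit.
Unset Printing Implicit Defensive.

Import Order.TTheory GRing.Theory Num.Theory.
Import numFieldNormedType.Exports.

Local Open Scope classical_set_scope.
Local Open Scope ring_scope.

Record digraph (n : nat) := Digraph {
  edge : rel 'I_n;
  edge_irr : irreflexive edge }.

Section Digraphs.
Variable n : nat.
Implicit Type G : digraph n.

Definition outdeg G (i : 'I_n) : nat := #|[set j | edge G i j]%SET|.
Definition indeg G (i : 'I_n) : nat := #|[set j | edge G j i]%SET|.

Definition balanced G : Prop := forall i, outdeg G i = indeg G i.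

Definition compl_edge G : rel 'I_n := fun i j => (i != j) && ~~ edge G i j.

Lemma compl_edge_irr G : irreflexive (compl_edge G).
Proof. by move=> i; rewrite /compl_edge eqxx. Qed.

Definition complement G : digraph n := Digraph (@compl_edge_irr G).

End Digraphs.

Section Euclidean.
Variables (R : realType) (n : nat).
Implicit Types x y : 'cV[R]_n.

(* The norm that MathComp-Analysis puts on matrices is the sup norm, so the
   Euclidean one is defined here. *)
Definition dot x y : R := \sum_i x i 0 * y i 0.
Definition enorm x : R := Num.sqrt (dot x x).

Definition all_ones : 'cV[R]_n := const_mx 1.

Definition zero_mean x : Prop := \sum_i x i 0 = 0.

Definition orthonormal_pair x y : Prop :=
  [/\ enorm x = 1, enorm y = 1 & dot x y = 0].

Definition quad_form (L : 'M[R]_n) x : R := (x^T *m L *m x) 0 0.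

End Euclidean.

Section AlgebraicConnectivity.
Variables (R : realType) (n : nat).
Implicit Type G : digraph n.

Definition adjacency G : 'M[R]_n := \matrix_(i, j) (edge G i j)%:R.
Definition degree_mx G : 'M[R]_n := diag_mx (\row_i (outdeg G i)%:R).
Definition laplacian G : 'M[R]_n := degree_mx G - adjacency G.

Definition unit_sphere_orth_ones : set 'cV[R]_n :=
  [set x | dot x (all_ones R n) = 0 /\ enorm x = 1].

(* For n >= 2 this infimum is a minimum: see alg_connectivity_min below. *)
Definition alg_connectivity G : R :=
  inf [set quad_form (laplacian G) x | x in unit_sphere_orth_ones].

End AlgebraicConnectivity.

Arguments unit_sphere_orth_ones R n : clear implicits.

Definition index_pairs (n : nat) : {set 'I_n * 'I_n} :=
  [set p : 'I_n * 'I_n | (p.1 < p.2)%N]%SET.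

Lemma card_index_pairs (n : nat) : #|index_pairs n| = 'C(n, 2).
Proof.
rewrite -sum1_card (eq_bigl (fun p : 'I_n * 'I_n => (p.1 < p.2)%N)); last first.
  by move=> p; rewrite inE.
rewrite -(pair_big_dep xpredT (fun i j : 'I_n => (i < j)%N) (fun _ _ => 1%N)) /=.
rewrite (exchange_big_dep xpredT) //= -bin2_sum big_mkord.
apply: eq_bigr => j _.
by rewrite -(big_ord_widen n (fun=> 1%N) (ltnW (ltn_ord j))) sum1_card card_ord.
Qed.

(* The dimension is 'C(n, 2) by card_index_pairs; the coordinates are listed in
   the order of the enumeration of index_pairs. *)
Definition grad (R : realType) (n : nat) (x : 'cV[R]_n) :
    'cV[R]_#|index_pairs n| :=
  \col_k `|x (enum_val k).1 0 - x (enum_val k).2 0|.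

Section Attained.
Variables (R : realType) (n : nat).

Lemma enorm1P (x : 'cV[R]_n) : (enorm x = 1) <-> (dot x x = 1).
Proof.
have d0 : 0 <= dot x x by apply: sumr_ge0 => i _; rewrite -expr2 sqr_ge0.
split=> [e1|d1]; last by rewrite /enorm d1 sqrtr1.
by rewrite -(sqr_sqrtr d0) -/(enorm x) e1 expr1n.
Qed.

Lemma sphere_nonempty : (2 <= n)%N -> unit_sphere_orth_ones R n !=set0.
Proof.
move=> n2.
pose i0 := Ordinal (ltnW n2 : (0 < n)%N); pose i1 := Ordinal n2.
have ne : i1 != i0 by [].
pose c : R := Num.sqrt 2^-1.
exists (\col_i (if i == i0 then c else if i == i1 then - c else 0)); split.
  rewrite /dot (bigD1 i0) //= (bigD1 i1) //= big1 => [|i /andP[/negPf h0 /negPf h1]].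
    by rewrite !mxE !eqxx (negPf ne) !mulr1 addr0 subrr.
  by rewrite !mxE h0 h1 mul0r.
apply/enorm1P.
rewrite /dot (bigD1 i0) //= (bigD1 i1) //= big1 => [|i /andP[/negPf h0 /negPf h1]].
  rewrite !mxE !eqxx (negPf ne) addr0 mulrNN -expr2 sqr_sqrtr ?invr_ge0 ?ler0n//.
  by rewrite [RHS]splitr div1r.
by rewrite !mxE h0 h1 mul0r.
Qed.

Lemma continuous_sum_fun (T : topologicalType) (I : Type) (r : seq I)
    (f : I -> T -> R) :
  (forall i, continuous (f i)) -> continuous (fun t => \sum_(i <- r) f i t).
Proof.
move=> cf; elim: r => [|i r IH] t.
  under eq_fun do rewrite big_nil; exact: cvg_cst.
under eq_fun do rewrite big_cons.
by apply: continuousD; [exact: cf|exact: IH].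
Qed.

Lemma alg_connectivity_min (G : digraph n) : (2 <= n)%N ->
  exists2 x, unit_sphere_orth_ones R n x &
    quad_form (laplacian R G) x = alg_connectivity R G /\
    forall y, unit_sphere_orth_ones R n y ->
      alg_connectivity R G <= quad_form (laplacian R G) y.
Proof.
move=> n2.
have cc (i : 'I_n) : continuous (fun u : 'rV[R]_n => u 0 i) by exact: coord_continuous.
pose A : set 'rV[R]_n := [set u | unit_sphere_orth_ones R n u^T].
pose g1 := fun u : 'rV[R]_n => \sum_i u 0 i.
pose g2 := fun u : 'rV[R]_n => \sum_i u 0 i * u 0 i.
have c1 : continuous g1 by exact: continuous_sum_fun.
have c2 : continuous g2.
  by apply: continuous_sum_fun => i u; apply: continuousM; exact: cc.
have AE : A = (g1 @^-1` [set 0]) `&` (g2 @^-1` [set 1]).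
  apply/seteqP; split=> u; rewrite /A /unit_sphere_orth_ones /g1 /g2 /= enorm1P /dot.
    move=> [h1 h2]; split; [apply: etrans h1|apply: etrans h2]; apply: eq_bigr => i _;
    by rewrite !mxE ?mulr1.
  move=> [h1 h2]; split; [apply: etrans h1|apply: etrans h2]; apply: eq_bigr => i _;
  by rewrite !mxE ?mulr1.
have clA : closed A.
  rewrite AE; apply: closedI; apply: preimage_closed => //;
  exact: closed_eq.
pose f (u : 'rV[R]_n) := quad_form (laplacian R G) u^T.
have cf : continuous f.
  have -> : f = fun u => \sum_j (\sum_i u 0 i * laplacian R G i j) * u 0 j.
    apply/funext => u; rewrite /f /quad_form mxE; apply: eq_bigr => j _.
    rewrite !mxE; congr (_ * _); apply: eq_bigr => i _.
    by rewrite !mxE.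
  apply: continuous_sum_fun => j u; apply: continuousM; last exact: cc.
  apply: continuous_sum_fun => i v; apply: continuousM; first exact: cc.
  exact: cst_continuous.
have cA : compact A.
  apply: bounded_closed_compact => //.
  exists 1; split=> // M M1 u; rewrite AE => -[_ /= h].
  apply: le_trans (ltW M1).
  rewrite [leLHS]/Num.Def.normr /= mx_normrE.
  apply: bigmax_le => // -[i j] _ /=; rewrite (ord1 i).
  rewrite -(@ler_pXn2r _ 2) ?nnegrE// expr1n -normrX ger0_norm ?sqr_ge0//.
  rewrite -h /g2 (bigD1 j) //= expr2 lerDl.
  by apply: sumr_ge0 => k _; rewrite -expr2 sqr_ge0.
have A0 : A !=set0.
  have [x Sx] := sphere_nonempty n2.
  by exists x^T; rewrite /A /= trmxK.
have [c cinA cmin] := compact_EVT_min A0 cA (continuous_subspaceT cf).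
have Sc : unit_sphere_orth_ones R n c^T by rewrite inE in cinA.
pose Q := [set quad_form (laplacian R G) x | x in unit_sphere_orth_ones R n].
have lbQ : lbound Q (quad_form (laplacian R G) c^T).
  move=> _ [x Sx <-]; have := cmin x^T; rewrite /f trmxK; apply.
  by rewrite inE /A /= trmxK.
have Q0 : Q !=set0 by exists (quad_form (laplacian R G) c^T), c^T.
have E : quad_form (laplacian R G) c^T = alg_connectivity R G.
  apply/eqP; rewrite eq_le; apply/andP; split; first exact: lb_le_inf.
  by apply: ge_inf; [exists (quad_form (laplacian R G) c^T)|exists c^T].
exists c^T => //; split=> // y Sy; rewrite -E.
by apply: lbQ; exists y.
Qed.

End Attained.

(* Main.v *)
(** For a balanced digraph [2 x^T L x] is the sum of [(x_i - x_j)^2] over the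
    edges [(i, j)].  Hence [alpha(G) + alpha(compl G)], minimised over [G], is
    half of the minimum over zero-mean unit [x], [y] of
    [sum_(i, j) min ((x_i - x_j)^2, (y_i - y_j)^2)]: given [x] and [y], the best
    choice of edges is symmetric, hence balanced.  Since
    [2 min (a^2, b^2) = a^2 + b^2 - |a + b| |a - b|], that sum is
    [2n - 1/2 sum_(i, j) |u_i - u_j| |v_i - v_j|] with [u = x + y], [v = x - y],
    two orthogonal vectors; on the other hand
    [||grad u - grad v||^2 = 2n - sum_(i, j) |u_i - u_j| |v_i - v_j|] when [u]
    and [v] are orthonormal.  So both statements bound the same cross sum by
    [2n - 2], up to normalising [u] and [v]. *)
Require Import Defs.
From mathcomp Require Import all_boot all_order all_algebra.
From mathcomp Require Import all_classical all_reals all_analysis.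
From mathcomp Require Import ring lra.

Set Implicit Arguments.
Unset Strict Implicit.
Unset Printing Implicit Defensive.

Import Order.TTheory GRing.Theory Num.Theory.
Local Open Scope ring_scope.

(** * Inner products and sums of differences over pairs of indices *)

Section Differences.
Variables (R : realType) (n : nat).
Implicit Types (x y u : 'cV[R]_n) (c d : R).

Definition cross_sum x y : R :=
  \sum_i \sum_j `|x i 0 - x j 0| * `|y i 0 - y j 0|.

Definition min_sum x y : R :=
  \sum_i \sum_j Num.min ((x i 0 - x j 0) ^+ 2) ((y i 0 - y j 0) ^+ 2).

Lemma dot_ge0 x : 0 <= dot x x.
Proof. by apply: sumr_ge0 => i _; rewrite -expr2 sqr_ge0. Qed.

Lemma enorm_sqr x : enorm x ^+ 2 = dot x x.
Proof. by rewrite /enorm sqr_sqrtr ?dot_ge0. Qed.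

Lemma dotC x y : dot x y = dot y x.
Proof. by apply: eq_bigr => i _; rewrite mulrC. Qed.

Lemma dotDl x y u : dot (x + y) u = dot x u + dot y u.
Proof. by rewrite /dot -big_split; apply: eq_bigr => i _; rewrite !mxE mulrDl. Qed.

Lemma dotZl c x y : dot (c *: x) y = c * dot x y.
Proof. by rewrite /dot mulr_sumr; apply: eq_bigr => i _; rewrite !mxE mulrA. Qed.

Lemma dotBl x y u : dot (x - y) u = dot x u - dot y u.
Proof. by rewrite -scaleN1r dotDl dotZl mulN1r. Qed.

Lemma dotDr x y u : dot u (x + y) = dot u x + dot u y.
Proof. by rewrite dotC dotDl !(dotC u). Qed.

Lemma dotBr x y u : dot u (x - y) = dot u x - dot u y.
Proof. by rewrite dotC dotBl !(dotC u). Qed.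

Lemma dotZr c x y : dot x (c *: y) = c * dot x y.
Proof. by rewrite dotC dotZl dotC. Qed.

Lemma dot_eq0 x : dot x x = 0 -> x = 0.
Proof.
move=> /eqP; rewrite psumr_eq0 => [/allP h|i _]; last by rewrite -expr2 sqr_ge0.
apply/matrixP => i j; rewrite (ord1 j) mxE.
by have := h i (mem_index_enum i); rewrite mulf_eq0 orbb => /eqP.
Qed.

Lemma zero_meanE x : zero_mean x <-> dot x (all_ones R n) = 0.
Proof.
rewrite /zero_mean /dot.
by under [in X in _ <-> X]eq_bigr do rewrite mxE mulr1.
Qed.

Lemma sphereP x :
  unit_sphere_orth_ones R n x <-> zero_mean x /\ dot x x = 1.
Proof. by rewrite zero_meanE /unit_sphere_orth_ones /= enorm1P. Qed.

(** When the square is expanded, the mixed terms sum to zero because [x] has zero mean. *)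
Lemma sum_sqr_diff x : zero_mean x ->
  \sum_i \sum_j (x i 0 - x j 0) ^+ 2 = 2 * n%:R * dot x x.
Proof.
rewrite /zero_mean => x0.
transitivity (\sum_i (n%:R * (x i 0 * x i 0) + dot x x)).
  apply: eq_bigr => i _.
  transitivity (\sum_j (x i 0 * x i 0 + (x j 0 * x j 0 - 2 * x i 0 * x j 0))).
    by apply: eq_bigr => j _; ring.
  rewrite big_split sumrB sumr_const card_ord -mulr_sumr /= x0 mulr0 subr0.
  by rewrite mulr_natl.
rewrite big_split -mulr_sumr sumr_const card_ord /= -mulr_natl -/(dot x x).
by ring.
Qed.

Lemma cross_sumZ c d x y :
  cross_sum (c *: x) (d *: y) = `|c| * `|d| * cross_sum x y.
Proof.
rewrite /cross_sum mulr_sumr; apply: eq_bigr => i _.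
rewrite mulr_sumr; apply: eq_bigr => j _.
by rewrite !mxE -!mulrBr !normrM; ring.
Qed.

(** Links the coordinates of [grad], indexed by pairs [i < j], to double sums over all ordered
    pairs. *)
Lemma sum_index_pairs (f : 'I_n -> 'I_n -> R) :
  (forall i j, f i j = f j i) -> (forall i, f i i = 0) ->
  \sum_i \sum_j f i j = 2 * \sum_(p in index_pairs n) f p.1 p.2.
Proof.
move=> fC f0.
have -> : \sum_(p in index_pairs n) f p.1 p.2 =
          \sum_(i < n) \sum_(j < n | (i < j)%N) f i j.
  by rewrite pair_big_dep /=; apply: eq_bigl => p; rewrite inE.
rewrite mulrDl mul1r [X in _ = _ + X](exchange_big_dep xpredT) //=.
rewrite -big_split; apply: eq_bigr => i _ /=.
rewrite [LHS](bigID (fun j : 'I_n => (i < j)%N)) /=; congr (_ + _).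
rewrite (bigD1 i) ?ltnn //= f0 add0r; apply: eq_big => [j|j _]; last exact: fC.
by rewrite -leqNgt ltn_neqAle andbC.
Qed.

End Differences.

(** * Gradient distance and minimum sum in terms of cross sums *)

Section Gradients.
Variables (R : realType) (n : nat).
Implicit Types x y : 'cV[R]_n.

Lemma grad_dist x y : zero_mean x -> zero_mean y ->
  enorm (grad x - grad y) ^+ 2 =
  n%:R * (dot x x + dot y y) - cross_sum x y.
Proof.
move=> x0 y0; apply: (@mulfI _ 2); first by rewrite pnatr_eq0.
pose f i j := (`|x i 0 - x j 0| - `|y i 0 - y j 0|) ^+ 2.
transitivity (\sum_i \sum_j f i j).
  rewrite sum_index_pairs => [|i j|i]; last 2 first.
  - by rewrite /f distrC [X in _ - X]distrC.
  - by rewrite /f !subrr expr0n.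
  rewrite enorm_sqr big_enum_val /dot; congr (_ * _).
  by apply: eq_bigr => k _; rewrite !mxE.
rewrite mulrBr mulrCA mulrDr mulrDr !mulrA ![_ * 2]mulrC -!sum_sqr_diff //.
rewrite /cross_sum mulr_sumr -big_split -sumrB; apply: eq_bigr => i _ /=.
rewrite mulr_sumr -big_split -sumrB; apply: eq_bigr => j _ /=.
by rewrite /f sqrrB !real_normK ?num_real // -mulr_natl; ring.
Qed.

Lemma min_sumE x y : zero_mean x -> zero_mean y ->
  2 * min_sum x y =
  2 * n%:R * (dot x x + dot y y) - cross_sum (x + y) (x - y).
Proof.
move=> x0 y0.
rewrite mulrDr -!sum_sqr_diff // /min_sum /cross_sum mulr_sumr.
rewrite -big_split -sumrB; apply: eq_bigr => i _ /=.
rewrite mulr_sumr -big_split -sumrB; apply: eq_bigr => j _ /=.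
rewrite !mxE -normrM.
set a := x i 0 - x j 0; set b := y i 0 - y j 0.
have -> : (x i 0 + y i 0 - (x j 0 + y j 0)) * (x i 0 - y i 0 - (x j 0 - y j 0))
        = a ^+ 2 - b ^+ 2 by rewrite /a /b; ring.
(* A single comparison of [a ^+ 2] with [b ^+ 2] settles both the minimum and the absolute value of
   the difference. *)
by case: lerP => _; ring.
Qed.

End Gradients.

(** * Laplacian quadratic forms of balanced digraphs *)

Section QuadraticForm.
Variables (R : realType) (n : nat).
Implicit Types (G : digraph n) (x y : 'cV[R]_n).

Lemma outdegE G i : (outdeg G i)%:R = \sum_j (edge G i j)%:R :> R.
Proof.
rewrite /outdeg -sum1_card natr_sum big_mkcond; apply: eq_bigr => j _.
by rewrite inE; case: edge.
Qed.

Lemma indegE G i : (indeg G i)%:R = \sum_j (edge G j i)%:R :> R.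
Proof.
rewrite /indeg -sum1_card natr_sum big_mkcond; apply: eq_bigr => j _.
by rewrite inE; case: edge.
Qed.

Lemma quad_formE G x : balanced G ->
  2 * quad_form (laplacian R G) x =
  \sum_i \sum_j (edge G i j)%:R * (x i 0 - x j 0) ^+ 2.
Proof.
move=> bG.
pose e i j : R := (edge G i j)%:R.
have qE : quad_form (laplacian R G) x =
    \sum_i (outdeg G i)%:R * x i 0 ^+ 2 -
    \sum_i \sum_j e i j * (x i 0 * x j 0).
  rewrite /quad_form /laplacian mulmxBr mulmxBl !mxE; congr (_ - _).
    apply: eq_bigr => i _; rewrite /degree_mx mul_mx_diag !mxE; ring.
  rewrite exchange_big; apply: eq_bigr => j _ /=.
  rewrite mxE mulr_suml; apply: eq_bigr => i _.
  by rewrite !mxE /e; ring.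
have outE : \sum_i (outdeg G i)%:R * x i 0 ^+ 2 =
            \sum_i \sum_j e i j * x i 0 ^+ 2.
  by apply: eq_bigr => i _; rewrite outdegE mulr_suml.
have inwE : \sum_i (outdeg G i)%:R * x i 0 ^+ 2 =
            \sum_i \sum_j e i j * x j 0 ^+ 2.
  rewrite [RHS]exchange_big; apply: eq_bigr => i _.
  by rewrite bG indegE mulr_suml.
(* Of the two copies of the degree term, one is spread over outgoing edges and the other, by
   balance, over incoming edges; together with the adjacency term they complete the square. *)
rewrite qE mulrBr mulrDl mul1r {1}outE inwE mulr_sumr.
rewrite -big_split -sumrB; apply: eq_bigr => i _ /=.
rewrite mulr_sumr -big_split -sumrB; apply: eq_bigr => j _ /=.
by rewrite -/(e i j); ring.
Qed.

Lemma balanced_complement G : balanced G -> balanced (complement G).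
Proof.
(* Degrees are compared in [R], where the indicator of a complementary edge is a genuine
   difference. *)
move=> bG i; apply/eqP; rewrite -(eqr_nat R) outdegE indegE.
have cE j k : (edge (complement G) j k)%:R = (j != k)%:R - (edge G j k)%:R :> R.
  rewrite /= /compl_edge; case: eqVneq => [->|_] /=.
    by rewrite edge_irr subr0.
  by case: edge; rewrite ?subrr ?subr0.
under eq_bigr do rewrite cE eq_sym.
under [in eqbRHS]eq_bigr do rewrite cE.
by rewrite !sumrB -outdegE -indegE bG.
Qed.

Lemma quad_form_complement G x y : balanced G ->
  2 * (quad_form (laplacian R G) x + quad_form (laplacian R (complement G)) y) =
  \sum_i \sum_j if edge G i j then (x i 0 - x j 0) ^+ 2 else (y i 0 - y j 0) ^+ 2.
Proof.
move=> bG; rewrite mulrDr !quad_formE //; last exact: balanced_complement.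
rewrite -big_split; apply: eq_bigr => i _ /=.
rewrite -big_split; apply: eq_bigr => j _ /=.
rewrite /compl_edge; case: eqVneq => [->|_] /=.
  by rewrite edge_irr !subrr expr0n !mul0r addr0.
by case: edge; rewrite /= ?mul0r ?mul1r ?addr0 ?add0r.
Qed.

(** Each ordered pair contributes one of the two squares, hence at least the smaller. *)
Lemma min_sum_le_quad_form G x y : balanced G ->
  min_sum x y <=
  2 * (quad_form (laplacian R G) x + quad_form (laplacian R (complement G)) y).
Proof.
move=> bG; rewrite quad_form_complement //.
apply: ler_sum => i _; apply: ler_sum => j _.
by case: edge; rewrite ge_min lexx ?orbT.
Qed.

Definition min_edge x y : rel 'I_n :=
  fun i j => (i != j) && ((x i 0 - x j 0) ^+ 2 <= (y i 0 - y j 0) ^+ 2).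

Lemma min_edge_irr x y : irreflexive (min_edge x y).
Proof. by move=> i; rewrite /min_edge eqxx. Qed.

Definition min_digraph x y : digraph n := Digraph (@min_edge_irr x y).

(** Squared differences do not change when [i] and [j] are swapped, so the edge relation is
    symmetric. *)
Lemma balanced_min_digraph x y : balanced (min_digraph x y).
Proof.
move=> i; apply: eq_card => j; rewrite !inE /= /min_edge eq_sym.
by rewrite -(sqrrN (x i 0 - _)) -(sqrrN (y i 0 - _)) !opprB.
Qed.

(** Equality case of [min_sum_le_quad_form]: edges select the smaller square, and on the diagonal
    both squares vanish. *)
Lemma min_sum_digraph x y :
  2 * (quad_form (laplacian R (min_digraph x y)) x +
       quad_form (laplacian R (complement (min_digraph x y))) y) =
  min_sum x y.
Proof.
rewrite quad_form_complement; last exact: balanced_min_digraph.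
apply: eq_bigr => i _; apply: eq_bigr => j _ /=.
rewrite /min_edge; case: eqVneq => [->|_] /=.
  by rewrite !subrr expr0n minxx.
by case: lerP.
Qed.

End QuadraticForm.

(** * Homogeneity of the cross-sum bound *)

Section ZeroMean.
Variables (R : realType) (n : nat).
Implicit Types (x y : 'cV[R]_n) (c : R).

Lemma zero_meanD x y : zero_mean x -> zero_mean y -> zero_mean (x + y).
Proof. by rewrite !zero_meanE dotDl => -> ->; rewrite addr0. Qed.

Lemma zero_meanZ c x : zero_mean x -> zero_mean (c *: x).
Proof. by rewrite !zero_meanE dotZl => ->; rewrite mulr0. Qed.

Lemma zero_meanB x y : zero_mean x -> zero_mean y -> zero_mean (x - y).
Proof.
by move=> x0 y0; rewrite -scaleN1r; apply: zero_meanD => //; apply: zero_meanZ.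
Qed.

(** Normalising both vectors scales the cross sum by the product of the norms; a zero vector cannot
    be normalised, but then both sides vanish. *)
Lemma cross_sum_le (K : R) x y :
  (forall u v : 'cV[R]_n, orthonormal_pair u v -> zero_mean u -> zero_mean v ->
     cross_sum u v <= K) ->
  zero_mean x -> zero_mean y -> dot x y = 0 ->
  cross_sum x y <= enorm x * enorm y * K.
Proof.
move=> hK x0 y0 xy.
have cross0 (z : 'cV[R]_n) : cross_sum (0 : 'cV[R]_n) z = 0.
  by have := cross_sumZ 0 1 z z; rewrite scale0r scale1r normr0 !mul0r.
have cross0r (z : 'cV[R]_n) : cross_sum z (0 : 'cV[R]_n) = 0.
  by have := cross_sumZ 1 0 z z; rewrite scale0r scale1r normr0 mulr0 !mul0r.
have enorm0 z : enorm z = 0 -> z = 0 :> 'cV[R]_n.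
  by move=> z0; apply: dot_eq0; rewrite -enorm_sqr z0 expr0n.
have [nx|nx] := eqVneq (enorm x) 0.
  by rewrite (enorm0 _ nx) cross0 -(enorm0 _ nx) nx !mul0r.
have [ny|ny] := eqVneq (enorm y) 0.
  by rewrite (enorm0 _ ny) cross0r -(enorm0 _ ny) ny mulr0 mul0r.
have normalised z : enorm z != 0 -> enorm ((enorm z)^-1 *: z) = 1 :> R.
  by move=> nz; apply/enorm1P; rewrite dotZl dotZr -enorm_sqr; field.
rewrite -[X in cross_sum X _](scalerKV nx) -[X in cross_sum _ X](scalerKV ny).
rewrite cross_sumZ !ger0_norm ?sqrtr_ge0 //.
apply: ler_wpM2l; first by rewrite mulr_ge0 ?sqrtr_ge0.
apply: hK; [split|exact: zero_meanZ|exact: zero_meanZ].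
- exact: normalised.
- exact: normalised.
- by rewrite dotZl dotZr xy !mulr0.
Qed.

End ZeroMean.

(** * Equivalence of the two bounds *)

Theorem theorem4p2 (R : realType) :
  (forall (n : nat) (G : digraph n), (2 <= n)%N -> balanced G ->
     1 <= alg_connectivity R G + alg_connectivity R (complement G))
  <->
  (forall (n : nat) (x y : 'cV[R]_n), (2 <= n)%N ->
     orthonormal_pair x y -> zero_mean x -> zero_mean y ->
     2 <= enorm (grad x - grad y) ^+ 2).
Proof.
split=> [hG n x y n2 [/enorm1P x1 /enorm1P y1 xy] x0 y0
        |hgrad n G n2 bG].
  (* The factor [c] makes [u] and [v] unit vectors, and [u + v], [u - v] are [2 * c] times [x],
     [y]. *)
  pose c : R := Num.sqrt 2^-1.
  have c2 : c * c = 2^-1 by rewrite -expr2 sqr_sqrtr ?invr_ge0.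
  pose u := c *: (x + y); pose v := c *: (x - y).
  have u0 : zero_mean u by apply: zero_meanZ; apply: zero_meanD.
  have v0 : zero_mean v by apply: zero_meanZ; apply: zero_meanB.
  have yx : dot y x = 0 by rewrite dotC.
  have u1 : dot u u = 1.
    by rewrite dotZl dotZr mulrA c2 !(dotDl, dotDr) x1 y1 xy yx; field.
  have v1 : dot v v = 1.
    by rewrite dotZl dotZr mulrA c2 !(dotBl, dotBr) x1 y1 xy yx; field.
  have minE : 2 * min_sum u v = 2 * enorm (grad x - grad y) ^+ 2.
    rewrite min_sumE // grad_dist // u1 v1 x1 y1.
    have -> : u + v = (2 * c) *: x.
      by apply/matrixP => i j; rewrite !mxE; ring.
    have -> : u - v = (2 * c) *: y.
      by apply/matrixP => i j; rewrite !mxE; ring.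
    rewrite cross_sumZ -normrM mulrACA c2 ger0_norm; last by lra.
    by field.
  (* For this digraph the two forms at [u] and [v] add up to half of [min_sum u v], and each bounds
     its algebraic connectivity from above. *)
  pose G := min_digraph u v.
  have [_ _ [_ /(_ u) minu]] := alg_connectivity_min R G n2.
  have [_ _ [_ /(_ v) minv]] := alg_connectivity_min R (complement G) n2.
  have := hG n G n2 (balanced_min_digraph u v).
  have {}minu := minu ((sphereP u).2 (conj u0 u1)).
  have {}minv := minv ((sphereP v).2 (conj v0 v1)).
  have := min_sum_digraph u v; rewrite -/G; lra.
(* The minimisers [x] and [y] need not be orthogonal, but having equal norms they make [x + y] and
   [x - y] orthogonal. *)
have [x /sphereP[x0 x1] [<- _]] := alg_connectivity_min R G n2.
have [y /sphereP[y0 y1] [<- _]] := alg_connectivity_min R (complement G) n2.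
have cross_le (u v : 'cV[R]_n) : orthonormal_pair u v -> zero_mean u -> zero_mean v ->
    cross_sum u v <= 2 * n%:R - 2 :> R.
  move=> uv u0 v0; have := hgrad n u v n2 uv u0 v0.
  case: uv => /enorm1P u1 /enorm1P v1 _.
  by rewrite grad_dist // u1 v1; lra.
have orth : dot (x + y) (x - y) = 0.
  by rewrite dotDl !dotBr x1 y1 (dotC y x); ring.
have := cross_sum_le cross_le (zero_meanD x0 y0) (zero_meanB x0 y0) orth.
(* The parallelogram law, followed by the inequality of arithmetic and geometric means. *)
have norms : enorm (x + y) ^+ 2 + enorm (x - y) ^+ 2 = 4.
  by rewrite !enorm_sqr !(dotBl, dotBr, dotDl, dotDr) x1 y1 (dotC y x); ring.
have prod_le2 : enorm (x + y) * enorm (x - y) <= 2.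
  by have := sqr_ge0 (enorm (x + y) - enorm (x - y)); nra.
have n2R : 0 <= 2 * n%:R - 2 :> R.
  by have : 2%:R <= n%:R :> R; [rewrite ler_nat|lra].
(* The cross sum of [x + y] and [x - y] is thus at most [2 * (2 * n - 2)], so [min_sum x y] is at
   least 2. *)
have := ler_wpM2r n2R prod_le2.
have := min_sumE x0 y0; rewrite x1 y1.
have := min_sum_le_quad_form x y bG.
lra.
Qed.
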